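(* Let $(\mathfrak{g},\mathfrak{n})$ be a Whittaker pair and assume that $\mathfrak{g}=\mathfrak{a}\oplus\mathfrak{n}$ (direct sum of vector spaces) for some Lie subalgebra $\mathfrak{a}$ of $\mathfrak{g}$. Then for every Lie algebra homomorphism $\lambda:\mathfrak{n}\to\mathbb{C}$ there exists a simple module $M\in\mathfrak{W}_{\mathfrak{n}}^{\mathfrak{g}}(\lambda)$ such that $W_{\lambda}(M)$ is one-dimensional.
   Context: Everything is over $\mathbb{C}$; Lie algebras may be infinite dimensional, of at most countable dimension. For a Lie algebra $\mathfrak{n}$ put $\mathfrak{n}_0=\mathfrak{n}$, $\mathfrak{n}_i=[\mathfrak{n}_{i-1},\mathfrak{n}]$ for $i>0$; $\mathfrak{n}$ is quasi-nilpotent if $\bigcap_{i\ge0}\mathfrak{n}_i=0$. A pair $(\mathfrak{g},\mathfrak{n})$ of a Lie algebra and a subalgebra is a Whittaker pair if $\mathfrak{n}$ is quasi-nilpotent and $\mathfrak{n}$ acts locally nilpotently on the adjoint $\mathfrak{n}$-module $\mathfrak{g}/\mathfrak{n}$; this includes that $\mathfrak{g}/\mathfrak{n}$ is a locally finite $\mathfrak{n}$-module ($\dim U(\mathfrak{n})w<\infty$ for all $w$), together with $\mathrm{ad}_u^k(w)=0$ for $k\gg0$ for all $u\in\mathfrak{n}$, $w\in\mathfrak{g}/\mathfrak{n}$. $\mathfrak{W}^{\mathfrak{g}}_{\mathfrak{n}}$ is the category of $\mathfrak{g}$-modules on which $\mathfrak{n}$ acts locally finitely (Whittaker modules). For a Lie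 algebra homomorphism $\lambda:\mathfrak{n}\to\mathbb{C}$ let $L_\lambda$ be the corresponding one-dimensional $\mathfrak{n}$-module. The block $\mathfrak{W}_{\mathfrak{n}}^{\mathfrak{g}}(\lambda)$ is the full subcategory of those $M\in\mathfrak{W}^{\mathfrak{g}}_{\mathfrak{n}}$ such that every composition factor of every finite dimensional $\mathfrak{n}$-submodule of $M$ is isomorphic to $L_\lambda$. $W_\lambda(M)=\{v\in M:xv=\lambda(x)v\text{ for all }x\in\mathfrak{n}\}$. *)

(* Defs.v *)
From HB Require Import structures.
From mathcomp Require Import all_boot all_order all_algebra.
From mathcomp Require Import generic_quotient ring_quotient.
From mathcomp Require Import boolp classical_sets functions cardinality.

Set Implicit Arguments.
Unset Strict Implicit.
Unset Printing Implicit Defensive.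

Import GRing.Theory.
Local Open Scope ring_scope.
Local Open Scope classical_set_scope.
Local Open Scope quotient_scope.
Local Open Scope card_scope.

Section LinearAlgebra.
Variables (K : fieldType) (V : lmodType K).
Implicit Types A B : set V.

Definition lin_span B : set V :=
  [set v | exists (s : seq V) (c : V -> K),
     (forall x, x \in s -> B x) /\ v = \sum_(x <- s) c x *: x].

Definition lin_free B : Prop :=
  forall (s : seq V) (c : V -> K), uniq s -> (forall x, x \in s -> B x) ->
    \sum_(x <- s) c x *: x = 0 -> forall x, x \in s -> c x = 0.

Definition is_basis A B : Prop := lin_free B /\ lin_span B = A.

(* For a set A that is not a linear subspace the next three are false. *)
Definition has_dim (d : nat) A : Prop := exists2 B, is_basis A B & B #= `I_d.
Definition fin_dim A : Prop := exists2 B, is_basis A B & finite_set B.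
Definition countable_dim A : Prop := exists2 B, is_basis A B & countable B.

Definition direct_sum A B : Prop :=
  A `&` B = [set 0] /\ [set a + b | a in A & b in B] = [set: V].

End LinearAlgebra.

HB.mixin Record Lmodule_isLie (K : fieldType) L of GRing.Lmodule K L := {
  lie : L -> L -> L;
  lie_linearl : forall z, linear (lie^~ z);
  lie_linearr : forall z, linear (lie z);
  liexx : forall x, lie x x = 0;
  lie_jacobi : forall x y z,
    lie x (lie y z) + lie y (lie z x) + lie z (lie x y) = 0
}.

#[short(type="lieType")]
HB.structure Definition Lie (K : fieldType) :=
  {L of GRing.Lmodule K L & Lmodule_isLie K L}.

HB.mixin Record Lmodule_isLieModule (K : fieldType) (g : lieType K) M
    of GRing.Lmodule K M := {
  lact : g -> M -> M;
  lact_linearl : forall v, linear (lact^~ v);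
  lact_linearr : forall x, linear (lact x);
  lact_lie : forall x y v,
    lact (lie x y) v = lact x (lact y v) - lact y (lact x v)
}.

#[short(type="lieModType")]
HB.structure Definition LieModule (K : fieldType) (g : lieType K) :=
  {M of GRing.Lmodule K M & Lmodule_isLieModule K g M}.

Section LieTheory.
Variables (K : fieldType) (g : lieType K).

Lemma lieDl (z x y : g) : lie (x + y) z = lie x z + lie y z.
Proof. by have := lie_linearl z 1 x y; rewrite /= !scale1r. Qed.

Lemma lieDr (z x y : g) : lie z (x + y) = lie z x + lie z y.
Proof. by have := lie_linearr z 1 x y; rewrite !scale1r. Qed.

Lemma lie0r (x : g) : lie x 0 = 0.
Proof. by apply: (addIr (lie x 0)); rewrite -lieDr !add0r. Qed.

Lemma lieNr (x y : g) : lie x (- y) = - lie x y.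
Proof. by apply/eqP; rewrite -addr_eq0 -lieDr addNr lie0r. Qed.

Lemma lieC (x y : g) : lie x y = - lie y x.
Proof.
apply/eqP; rewrite -addr_eq0; apply/eqP.
by have := liexx (x + y); rewrite lieDl !lieDr !liexx add0r addr0.
Qed.

Variable M : lieModType g.

Lemma lactBr (x : g) (v w : M) : lact x (v - w) = lact x v - lact x w.
Proof.
by rewrite addrC -scaleN1r lact_linearr scaleN1r addrC.
Qed.

End LieTheory.

Record lieHom (K : fieldType) (g h : lieType K) := LieHom {
  lieHom_fun :> {linear g -> h};
  lieHom_lie : forall x y, lieHom_fun (lie x y) = lie (lieHom_fun x) (lieHom_fun y)
}.

Definition lie_mod_iso (K : fieldType) (g : lieType K) (M N : lieModType g) : Prop :=
  exists2 f : {linear M -> N}, bijective f &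
    forall (x : g) v, f (lact x v) = lact x (f v).

(* The ground field as the one-dimensional (abelian) Lie algebra. *)
Section FieldLie.
Variable K : fieldType.

Let lie0 (x y : K^o) : K^o := 0.
Fact lie0_linear (z : K^o) : linear (fun x : K^o => 0 : K^o).
Proof. by move=> a x y; rewrite scaler0 addr0. Qed.
Fact lie0_jacobi (x y z : K^o) :
  lie0 x (lie0 y z) + lie0 y (lie0 z x) + lie0 z (lie0 x y) = 0.
Proof. by rewrite /lie0 !addr0. Qed.

HB.instance Definition _ := Lmodule_isLie.Build K K^o
  lie0_linear lie0_linear (fun x => erefl) lie0_jacobi.
End FieldLie.

Record lieSub (K : fieldType) (g : lieType K) := LieSub {
  lieSub_set :> set g;
  lieSub0 : lieSub_set 0;
  lieSubP : forall c x y, lieSub_set x -> lieSub_set y -> lieSub_set (c *: x + y);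
  lieSub_lie : forall x y, lieSub_set x -> lieSub_set y -> lieSub_set (lie x y)
}.

Section SubLie.
Variables (K : fieldType) (g : lieType K) (n : lieSub g).

Definition lieSub_pred : {pred g} := fun x => x \in (n : set g).

Fact lieSub_submod_closed : submod_closed lieSub_pred.
Proof.
split=> [|c x y]; first exact/mem_set/lieSub0.
by move=> /set_mem nx /set_mem ny; apply/mem_set/lieSubP.
Qed.

HB.instance Definition _ :=
  GRing.isSubmodClosed.Build K g lieSub_pred lieSub_submod_closed.

Definition lieSubType : Type := {x : g | lieSub_pred x}.

HB.instance Definition _ := SubChoice.on lieSubType.
HB.instance Definition _ := [SubChoice_isSubLmodule of lieSubType by <:].

Definition subLie_lie (x y : lieSubType) : lieSubType :=
  exist _ (lie (val x) (val y)) (mem_set (lieSub_lie (set_mem (valP x)) (set_mem (valP y)))).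

Fact subLie_linearl z : linear (subLie_lie^~ z).
Proof. by move=> c x y; apply/val_inj; exact: lie_linearl. Qed.
Fact subLie_linearr z : linear (subLie_lie z).
Proof. by move=> c x y; apply/val_inj; exact: lie_linearr. Qed.
Fact subLie_xx x : subLie_lie x x = 0.
Proof. by apply/val_inj; exact: liexx. Qed.
Fact subLie_jacobi x y z : subLie_lie x (subLie_lie y z) +
  subLie_lie y (subLie_lie z x) + subLie_lie z (subLie_lie x y) = 0.
Proof. by apply/val_inj; exact: lie_jacobi. Qed.

HB.instance Definition _ := Lmodule_isLie.Build K lieSubType
  subLie_linearl subLie_linearr subLie_xx subLie_jacobi.

End SubLie.

Record submod (K : fieldType) (g : lieType K) (M : lieModType g) := Submod {
  submod_set :> set M;
  submod0 : submod_set 0;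
  submodP : forall c v w, submod_set v -> submod_set w -> submod_set (c *: v + w);
  submod_lact : forall (x : g) v, submod_set v -> submod_set (lact x v)
}.

Section Submod.
Variables (K : fieldType) (g : lieType K) (M : lieModType g) (S : submod M).

Definition submod_pred : {pred M} := fun v => v \in (S : set M).

Fact submod_submod_closed : submod_closed submod_pred.
Proof.
split=> [|c x y]; first exact/mem_set/submod0.
by move=> /set_mem Sx /set_mem Sy; apply/mem_set/submodP.
Qed.

HB.instance Definition _ :=
  GRing.isSubmodClosed.Build K M submod_pred submod_submod_closed.

Definition submodType : Type := {v : M | submod_pred v}.

HB.instance Definition _ := SubChoice.on submodType.
HB.instance Definition _ := [SubChoice_isSubLmodule of submodType by <:].

Definition sub_lact (x : g) (v : submodType) : submodType :=
  exist _ (lact x (val v)) (mem_set (submod_lact x (set_mem (valP v)))).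

Fact sub_lact_linearl v : linear (sub_lact^~ v).
Proof. by move=> c x y; apply/val_inj; exact: lact_linearl. Qed.
Fact sub_lact_linearr x : linear (sub_lact x).
Proof. by move=> c v w; apply/val_inj; exact: lact_linearr. Qed.
Fact sub_lact_lie x y v :
  sub_lact (lie x y) v = sub_lact x (sub_lact y v) - sub_lact y (sub_lact x v).
Proof. by apply/val_inj; exact: lact_lie. Qed.

HB.instance Definition _ := Lmodule_isLieModule.Build K g submodType
  sub_lact_linearl sub_lact_linearr sub_lact_lie.

Definition quotMod : Type := Quotient.quot submod_pred.

HB.instance Definition _ := GRing.Zmodule.on quotMod.
HB.instance Definition _ := Quotient.on quotMod.

Definition toQuot (v : M) : quotMod := \pi_quotMod v.

Lemma toQuotP v w : toQuot v = toQuot w <-> submod_set S (v - w).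
Proof.
split=> [/eqP|Svw]; last apply/eqP.
  by rewrite /toQuot -Quotient.idealrBE => /set_mem.
by rewrite /toQuot -Quotient.idealrBE; apply/mem_set.
Qed.

Lemma toQuotK v : toQuot (repr v) = v.
Proof. exact: reprK. Qed.

Lemma toQuotD v w : toQuot (v + w) = toQuot v + toQuot w.
Proof. exact: (raddfD (\pi_(Quotient.quot submod_pred))). Qed.

Lemma toQuotB v w : toQuot (v - w) = toQuot v - toQuot w.
Proof. exact: (raddfB (\pi_(Quotient.quot submod_pred))). Qed.

Definition quot_scale (c : K) (v : quotMod) : quotMod := toQuot (c *: repr v).
Definition quot_lact (x : g) (v : quotMod) : quotMod := toQuot (lact x (repr v)).

Lemma toQuotZ_subproof c v : quot_scale c (toQuot v) = toQuot (c *: v).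
Proof.
apply/toQuotP; rewrite -scalerBr -[_ *: _]addr0.
by apply: submodP (submod0 S); apply/toQuotP; rewrite toQuotK.
Qed.

Lemma toQuot_lact_subproof x v : quot_lact x (toQuot v) = toQuot (lact x v).
Proof.
by apply/toQuotP; rewrite -lactBr; apply: submod_lact; apply/toQuotP; rewrite toQuotK.
Qed.

Fact quot_scaleA a b v : quot_scale a (quot_scale b v) = quot_scale (a * b) v.
Proof. by rewrite -(toQuotK v) !toQuotZ_subproof scalerA. Qed.
Fact quot_scale1 : left_id 1 quot_scale.
Proof. by move=> v; rewrite -(toQuotK v) toQuotZ_subproof scale1r. Qed.
Fact quot_scaleDr : right_distributive quot_scale +%R.
Proof.
move=> a v w; rewrite -(toQuotK v) -(toQuotK w) -toQuotD !toQuotZ_subproof.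
by rewrite scalerDr toQuotD.
Qed.
Fact quot_scaleDl v : {morph quot_scale^~ v : a b / a + b}.
Proof. by move=> a b; rewrite -(toQuotK v) !toQuotZ_subproof scalerDl toQuotD. Qed.

HB.instance Definition _ := GRing.Zmodule_isLmodule.Build K quotMod
  quot_scaleA quot_scale1 quot_scaleDr quot_scaleDl.

Lemma toQuotZ c v : toQuot (c *: v) = c *: toQuot v.
Proof. by rewrite -toQuotZ_subproof. Qed.

Fact quot_lact_linearl v : linear (quot_lact^~ v).
Proof.
move=> c x y; rewrite -(toQuotK v) /= !toQuot_lact_subproof.
by rewrite -toQuotZ -toQuotD; congr toQuot; exact: lact_linearl.
Qed.
Fact quot_lact_linearr x : linear (quot_lact x).
Proof.
move=> c v w; rewrite -(toQuotK v) -(toQuotK w) -toQuotZ -toQuotD.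
by rewrite !toQuot_lact_subproof -toQuotZ -toQuotD; congr toQuot; exact: lact_linearr.
Qed.
Fact quot_lact_lie x y v :
  quot_lact (lie x y) v = quot_lact x (quot_lact y v) - quot_lact y (quot_lact x v).
Proof. by rewrite -(toQuotK v) !toQuot_lact_subproof lact_lie toQuotB. Qed.

HB.instance Definition _ := Lmodule_isLieModule.Build K g quotMod
  quot_lact_linearl quot_lact_linearr quot_lact_lie.

Lemma toQuot_lact (x : g) v : toQuot (lact x v) = lact x (toQuot v).
Proof. by rewrite -toQuot_lact_subproof. Qed.

End Submod.

(* The subquotient B / (A :&: B) of M; it is B / A when A is contained in B. *)
Section Subquotient.
Variables (K : fieldType) (g : lieType K) (M : lieModType g) (A B : submod M).

Definition submod_comap_set : set (submodType B) := [set v | submod_set A (val v)].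

Fact submod_comap0 : submod_comap_set 0.
Proof. exact: submod0. Qed.
Fact submod_comapP c v w :
  submod_comap_set v -> submod_comap_set w -> submod_comap_set (c *: v + w).
Proof. by rewrite /submod_comap_set /=; exact: submodP. Qed.
Fact submod_comap_lact (x : g) v :
  submod_comap_set v -> submod_comap_set (lact x v).
Proof. exact: submod_lact. Qed.

Definition submod_comap : submod (submodType B) :=
  Submod submod_comap0 submod_comapP submod_comap_lact.

Definition subquotMod : Type := quotMod submod_comap.
HB.instance Definition _ := LieModule.on subquotMod.

End Subquotient.

Section ModuleProperties.
Variables (K : fieldType) (g : lieType K) (M : lieModType g).

Definition simple_module : Prop :=
  (exists v : M, v != 0) /\
  forall S : submod M, S = [set 0] :> set M \/ S = [set: M] :> set M.

(* U(g) w : the enveloping algebra U(g) is spanned by the monomials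
   x_1 x_2 ... x_k in elements of g. *)
Definition U_orbit (w : M) : set M :=
  lin_span [set foldr lact w xs | xs in [set: seq g]].

Definition locally_finite : Prop := forall w : M, fin_dim (U_orbit w).

Definition locally_nilpotent : Prop :=
  locally_finite /\
  forall (u : g) (w : M), exists k0 : nat,
    forall k : nat, (k0 <= k)%N -> iter k (lact u) w = 0.

End ModuleProperties.

Definition composition_series (K : fieldType) (g : lieType K) (M : lieModType g)
    (k : nat) (F : nat -> submod M) : Prop :=
  [/\ F 0%N = [set 0] :> set M,
      F k = [set: M] :> set M
    & forall i, (i < k)%N ->
        F i `<=` F i.+1 /\ simple_module (subquotMod (F i) (F i.+1))].

Definition composition_factor (K : fieldType) (g : lieType K)
    (M Q : lieModType g) : Prop :=
  exists (k : nat) (F : nat -> submod M),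
    composition_series k F /\
    exists2 i, (i < k)%N & lie_mod_iso Q (subquotMod (F i) (F i.+1)).

(* An alias of g carrying the adjoint module structure. *)
Definition adjMod (K : fieldType) (g : lieType K) : Type := g.

Section Adjoint.
Variables (K : fieldType) (g : lieType K).

HB.instance Definition _ := GRing.Lmodule.on (adjMod g).

Definition adj_lact (x : g) (y : adjMod g) : adjMod g := lie x y.

Fact adj_lact_lie x y v :
  adj_lact (lie x y) v = adj_lact x (adj_lact y v) - adj_lact y (adj_lact x v).
Proof.
rewrite /adj_lact; have := @lie_jacobi K g x y v.
rewrite (lieC v (lie x y)) (lieC v x) lieNr => /eqP.
by rewrite subr_eq0 => /eqP.
Qed.

HB.instance Definition _ := Lmodule_isLieModule.Build K g (adjMod g)
  (@lie_linearl K g) (@lie_linearr K g) adj_lact_lie.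
End Adjoint.

(* An alias of M carrying the restriction of the action to n. *)
Definition resMod (K : fieldType) (g : lieType K) (n : lieSub g)
  (M : lieModType g) : Type := M.

Section Restriction.
Variables (K : fieldType) (g : lieType K) (n : lieSub g) (M : lieModType g).

HB.instance Definition _ := GRing.Lmodule.on (resMod n M).

Definition res_lact (x : lieSubType n) (v : resMod n M) : resMod n M :=
  lact (val x) (v : M).

Fact res_lact_linearl v : linear (res_lact^~ v).
Proof. by move=> c x y; exact: lact_linearl. Qed.
Fact res_lact_linearr x : linear (res_lact x).
Proof. exact: lact_linearr. Qed.
Fact res_lact_lie x y v :
  res_lact (lie x y) v = res_lact x (res_lact y v) - res_lact y (res_lact x v).
Proof. exact: lact_lie. Qed.

HB.instance Definition _ := Lmodule_isLieModule.Build K (lieSubType n) (resMod n M)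
  res_lact_linearl res_lact_linearr res_lact_lie.
End Restriction.

(* L_lambda: an alias of K on which x acts as multiplication by lambda x. *)
Definition charMod (K : fieldType) (n : lieType K) (lambda : lieHom n K^o) : Type :=
  K^o.

Section OneDimensional.
Variables (K : fieldType) (n : lieType K) (lambda : lieHom n K^o).

HB.instance Definition _ := GRing.Lmodule.on (charMod lambda).

Definition char_lact (x : n) (v : charMod lambda) : charMod lambda := (lambda x : K) *: v.

Fact char_lact_linearl v : linear (char_lact^~ v).
Proof. by move=> c x y; rewrite /char_lact linearP scalerDl scalerA. Qed.
Fact char_lact_linearr x : linear (char_lact x).
Proof. by move=> c v w; rewrite /char_lact scalerDr !scalerA mulrC. Qed.
Fact char_lact_lie x y v :
  char_lact (lie x y) v = char_lact x (char_lact y v) - char_lact y (char_lact x v).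
Proof.
rewrite /char_lact lieHom_lie !scalerA [lambda y * _]mulrC subrr.
exact: scale0r.
Qed.

HB.instance Definition _ := Lmodule_isLieModule.Build K n (charMod lambda)
  char_lact_linearl char_lact_linearr char_lact_lie.
End OneDimensional.

Section QuasiNilpotent.
Variables (K : fieldType) (n : lieType K).

Fixpoint lower_central (i : nat) : set n :=
  if i is j.+1 then lin_span [set lie x y | x in lower_central j & y in [set: n]]
  else [set: n].

Definition quasi_nilpotent : Prop := \bigcap_i lower_central i = [set 0].
End QuasiNilpotent.

Section Whittaker.
Variables (K : fieldType) (g : lieType K) (n : lieSub g).

Definition adj_sub : submod (resMod n (adjMod g)) :=
  @Submod K (lieSubType n) (resMod n (adjMod g)) n (lieSub0 n) (@lieSubP K g n)
    (fun x v nv => lieSub_lie (set_mem (valP x)) nv).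

Definition whittaker_pair : Prop :=
  quasi_nilpotent (lieSubType n) /\ locally_nilpotent (quotMod adj_sub).

Definition whittaker_module (M : lieModType g) : Prop := locally_finite (resMod n M).

Variable lambda : lieHom (lieSubType n) K^o.

Definition in_block (M : lieModType g) : Prop :=
  whittaker_module M /\
  forall F : submod (resMod n M), fin_dim F ->
    forall Q : lieModType (lieSubType n),
      composition_factor (submodType F) Q -> lie_mod_iso Q (charMod lambda).

Definition whittaker_vectors (M : lieModType g) : set M :=
  [set v | forall x : lieSubType n, lact (val x) v = (lambda x : K) *: v].
End Whittaker.

Arguments lower_central {K} n i _.
Arguments whittaker_vectors {K g n} lambda M _.

(* Main.v *)
Require Import Defs.
From HB Require Import structures.
From mathcomp Require Import all_boot all_order all_algebra all_field ring.
From mathcomp Require Import boolp classical_sets functions cardinality reals complex.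

(** Let g act on the dual of U(n) = C (x)_{U(a)} U(g), i.e. on the module
    coinduced from the trivial a-module.  Its lambda-Whittaker vectors are the
    multiples of the algebra morphism U(n) -> K extending lambda, and M is the
    g-submodule generated by that morphism.  Writing the a-part of the action as a
    recursion on words in n, whose last letter is moved past an element of g, makes
    this construction independent of the Poincare-Birkhoff-Witt theorem.

    By Engel's theorem, each vector of g/n is killed by all sufficiently long
    products of elements of n; hence each vector of M is killed by all
    sufficiently long products of elements x - lambda(x), x in n.  So every nonzero
    n-submodule of M contains a lambda-Whittaker vector, which gives at once that
    all composition factors are L_lambda and that M is simple. *)

Set Implicit Arguments.
Unset Strict Implicit.
Unset Printing Implicit Defensive.
Import GRing.Theory.
Local Open Scope ring_scope.
Local Open Scope classical_set_scope.

(** * Linear spans and bases of finitely spanned subspaces *)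

Section Spans.
Variables (K : fieldType) (V : lmodType K).
Implicit Types (A B P W : set V) (s t : seq V).

Definition linear_set W : Prop :=
  W 0 /\ forall c x y, W x -> W y -> W (c *: x + y).

Lemma linear_setD W x y : linear_set W -> W x -> W y -> W (x + y).
Proof. by move=> [_ WP] Wx; rewrite -[x]scale1r; exact: WP. Qed.

Lemma linear_setZ W c x : linear_set W -> W x -> W (c *: x).
Proof. by move=> [W0 WP] Wx; rewrite -[_ *: _]addr0; exact: WP. Qed.

Lemma linear_setB W x y : linear_set W -> W x -> W y -> W (x - y).
Proof. by move=> [_ WP] Wx Wy; rewrite addrC -scaleN1r; exact: WP. Qed.

Lemma linear_set_sum W (I : eqType) (r : seq I) (F : I -> V) : linear_set W ->
  (forall i, i \in r -> W (F i)) -> W (\sum_(i <- r) F i).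
Proof.
move=> hW WF; rewrite big_seq; apply: big_ind => //; first exact: (proj1 hW).
by move=> x y; exact: linear_setD.
Qed.

Lemma lin_span_min B W : linear_set W -> B `<=` W -> lin_span B `<=` W.
Proof.
move=> hW BW _ [s [c [sB ->]]]; apply: linear_set_sum => // x xs.
by apply: linear_setZ => //; exact/BW/sB.
Qed.

Lemma sub_lin_span B : B `<=` lin_span B.
Proof.
move=> x Bx; exists [:: x], (fun=> 1); rewrite big_seq1 scale1r; split=> // y.
by rewrite inE => /eqP ->.
Qed.

(** Coefficients in [lin_span] depend on the vector only, so two combinations can be added only
    along a common duplicate-free list, with the multiplicities absorbed into the coefficients. *)
Lemma sum_undup_mem (s t : seq V) (F : V -> V) : uniq t -> {subset s <= t} ->
  \sum_(x <- s) F x = \sum_(x <- t) F x *+ count_mem x s.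
Proof.
move=> ut; elim: s => [|y s IH] st.
  by rewrite big_nil big1 // => x _; rewrite mulr0n.
rewrite big_cons IH => [|x xs]; last by apply: st; rewrite inE xs orbT.
rewrite [RHS](eq_bigr (fun x => (if x == y then F x else 0) + F x *+ count_mem x s)).
  have e : [seq x <- t | x == y] = [:: y] by apply: filter_pred1_uniq; rewrite ?st ?mem_head.
  rewrite big_split /=; congr (_ + _).
  by rewrite -big_mkcond -big_filter e big_seq1.
move=> x _ /=; rewrite mulrnDr eq_sym; congr (_ + _).
by case: eqP => // _; rewrite mulr0n.
Qed.

Lemma lin_span_linear B : linear_set (lin_span B).
Proof.
split; first by exists [::], (fun=> 0); rewrite big_nil.
move=> a _ _ [s [c [sB ->]]] [t [d [tB ->]]].
exists (undup (s ++ t)).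
exists (fun x => a * c x *+ count_mem x s + d x *+ count_mem x t); split.
  by move=> x; rewrite mem_undup mem_cat => /orP[/sB|/tB].
rewrite scaler_sumr (@sum_undup_mem s (undup (s ++ t))) ?undup_uniq //; last first.
  by move=> x xs; rewrite mem_undup mem_cat xs.
rewrite (@sum_undup_mem t (undup (s ++ t))) ?undup_uniq //; last first.
  by move=> x xs; rewrite mem_undup mem_cat xs orbT.
rewrite -big_split; apply: eq_bigr => x _ /=.
by rewrite scalerDl scalerA !scalerMnl.
Qed.

Lemma lin_span_sub A B : A `<=` B -> lin_span A `<=` lin_span B.
Proof.
move=> AB; apply: lin_span_min; first exact: lin_span_linear.
by move=> x /AB; exact: sub_lin_span.
Qed.

Lemma lin_span_seq_coord s v : lin_span [set` s] v ->
  exists c : 'cV[K]_(size s), v = \sum_i c i 0 *: s`_i.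
Proof.
move: v; apply: lin_span_min.
  split; first by exists 0; rewrite big1 // => i _; rewrite mxE scale0r.
  move=> a _ _ [c ->] [d ->]; exists (a *: c + d).
  rewrite scaler_sumr -big_split; apply: eq_bigr => i _ /=.
  by rewrite !mxE scalerDl scalerA.
move=> x /= xs; have ix : (index x s < size s)%N by rewrite index_mem.
exists (delta_mx (Ordinal ix) 0); rewrite (bigD1 (Ordinal ix)) //= big1 => [|i /negPf ni].
  by rewrite mxE !eqxx scale1r nth_index // addr0.
by rewrite mxE ni scale0r.
Qed.

(** Induction on the spanning list: a basis of the part of [W] inside the span of the tail is
    completed by one vector of [W] outside that span, if there is one. *)
Lemma linear_set_basis s W : linear_set W -> W `<=` lin_span [set` s] ->
  exists t, is_basis W [set` t].
Proof.
elim: s W => [|x s IH] W hW Ws.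
  exists [::]; split; first by case=> // y r c _ /(_ _ (mem_head _ _)).
  apply/seteqP; split; last by move=> w /Ws; apply: lin_span_sub.
  by apply: lin_span_min => // y.
have hS := lin_span_linear [set` s].
have [Wsub|/existsNP[w0 /not_implyP[Ww0 nw0]]] := pselect (W `<=` lin_span [set` s]).
  exact: IH.
have [|w []//|t [tf tW]] := IH (W `&` lin_span [set` s]).
  split; first by split; [exact: (proj1 hW)|exact: (proj1 hS)].
  by move=> c v w [Wv Sv] [Ww Sw]; split; [exact: (proj2 hW)|exact: (proj2 hS)].
have dec v : lin_span [set` x :: s] v -> exists c u, lin_span [set` s] u /\ v = c *: x + u.
  move: v; apply: lin_span_min.
    split; first by exists 0, 0; split; [exact: (proj1 hS)|rewrite scale0r addr0].
    move=> c _ _ [d [u [Su ->]]] [d' [u' [Su' ->]]]; exists (c * d + d'), (c *: u + u').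
    by split; [exact: (proj2 hS)|rewrite scalerDr scalerA scalerDl addrACA].
  move=> y /=; rewrite inE => /predU1P[->|ys].
    by exists 1, 0; split; [exact: (proj1 hS)|rewrite scale1r addr0].
  by exists 0, y; split; [exact: sub_lin_span|rewrite scale0r add0r].
have tS y : lin_span [set` t] y -> lin_span [set` s] y by rewrite tW => -[].
have [c0 [u0 [Su0 w0E]]] := dec _ (Ws _ Ww0).
have c0N : c0 != 0.
  by apply/eqP => c00; apply: nw0; rewrite w0E c00 scale0r add0r.
exists (w0 :: t); split.
  move=> r c ur rB r0.
  have sub y : y \in r -> y != w0 -> y \in t.
    by move=> yr /negPf yw; have := rB _ yr; rewrite /= inE yw.
  have cw : w0 \in r -> c w0 = 0.
    move=> wr; apply/eqP/negPn/negP => cN; apply: nw0.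
    move: r0; rewrite (big_rem w0) //= => /eqP; rewrite addr_eq0 => /eqP e.
    rewrite -[w0]scale1r -(mulVf cN) -scalerA e; apply: linear_setZ => //.
    rewrite -scaleN1r; apply: linear_setZ => //; apply: linear_set_sum => // y.
    rewrite mem_rem_uniq // inE => /andP[yw yr].
    by apply: linear_setZ => //; apply/tS/sub_lin_span/sub.
  move=> y yr; have [yw|yw] := eqVneq y w0; first by rewrite yw; apply: cw; rewrite -yw.
  apply: (tf (rem w0 r)); rewrite ?rem_uniq //.
  - by move=> z; rewrite mem_rem_uniq // inE => /andP[zw zr]; exact: sub.
  - have [wr|wr] := boolP (w0 \in r); last by rewrite rem_id.
    by move: r0; rewrite (big_rem w0) //= cw // scale0r add0r.
  - by rewrite mem_rem_uniq // inE yw.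
apply/seteqP; split.
  apply: lin_span_min => // y /=; rewrite inE => /predU1P[->//|yt].
  by have : lin_span [set` t] y by [exact: sub_lin_span]; rewrite tW => -[].
move=> w Ww; have [c [u [Su wE]]] := dec _ (Ws _ Ww).
have hT := lin_span_linear [set` w0 :: t].
(* Subtracting [(c / c0) *: w0] cancels the coefficient of [x] and leaves a vector of [W] in the
   span of [s]. *)
rewrite -[w](subrK ((c / c0) *: w0)); apply: linear_setD => //; last first.
  by apply: linear_setZ => //; apply: sub_lin_span; rewrite /= mem_head.
apply: (@lin_span_sub [set` t]); first by move=> y /= yt; rewrite inE yt orbT.
rewrite tW; split; first by apply: linear_setB => //; exact: linear_setZ.
rewrite wE w0E scalerDr scalerA divfK // opprD addrACA subrr add0r.
by apply: linear_setB => //; exact: linear_setZ.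
Qed.

Lemma linear_set_fin_dim s W : linear_set W -> W `<=` lin_span [set` s] -> fin_dim W.
Proof.
by move=> hW /(linear_set_basis hW)[t tB]; exists [set` t].
Qed.

End Spans.

(** * Engel's theorem inside a finite dimensional associative algebra *)

Section Engel.
Variables (K : fieldType) (A : falgType K).
Implicit Types (L H : set A) (x y h : A).

(** Products of [p] elements of [L] kill [y] from the left; thus [ann L p 1] says that the algebra
    without unit generated by [L] is nilpotent. *)
Fixpoint ann L (p : nat) y : Prop :=
  if p is p'.+1 then forall x, L x -> ann L p' (x * y) else y = 0.

Lemma ann0 L p : ann L p 0.
Proof. by elim: p => //= p IH x _; rewrite mulr0. Qed.

Lemma annP L p c y z : ann L p y -> ann L p z -> ann L p (c *: y + z).
Proof.
elim: p y z => [|p IH] y z /=; first by move=> -> ->; rewrite scaler0 addr0.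
by move=> hy hz x Lx; rewrite mulrDr -scalerAr; apply: IH; [apply: hy|apply: hz].
Qed.

Lemma annD L p y z : ann L p y -> ann L p z -> ann L p (y + z).
Proof. by move=> hy; rewrite -[y]scale1r; exact: annP. Qed.

Lemma annZ L p c y : ann L p y -> ann L p (c *: y).
Proof. by move=> hy; rewrite -[_ *: _]addr0; apply: annP => //; exact: ann0. Qed.

Lemma annS L p y : ann L p y -> ann L p.+1 y.
Proof.
elim: p y => [|p IH] y; first by move=> /= -> x _; rewrite mulr0.
by move=> hy x Lx; apply: IH; exact: hy.
Qed.

Lemma ann_sub L H p y : H `<=` L -> ann L p y -> ann H p y.
Proof.
by move=> HL; elim: p y => //= p IH y hy x Hx; apply: IH; apply: hy; exact: HL.
Qed.

Definition bracket x y := x * y - y * x.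

(** Moving [h] past [x] costs only the term [bracket h x * y], whose first factor is again in
    [H]. *)
Lemma ann_norm H p x y : (forall h, H h -> H (bracket h x)) ->
  ann H p y -> ann H p (x * y).
Proof.
move=> nx; elim: p y => [|p IH] y; first by move=> /= ->; rewrite mulr0.
move=> hy h Hh.
have -> : h * (x * y) = x * (h * y) + bracket h x * y.
  by rewrite /bracket mulrBl !mulrA addrC subrK.
by apply: annD; [apply: IH; exact: hy|apply: hy; exact: nx].
Qed.

Lemma ann_iter H i p x y : (forall h, H h -> H (bracket h x)) ->
  ann H p y -> ann H p (x ^+ i * y).
Proof.
move=> nx hy; elim: i => [|i IH]; first by rewrite expr0 mul1r.
by rewrite exprS -mulrA; exact: ann_norm.
Qed.

Lemma ann_prod H p y (s : seq A) : ann H p y -> (p <= size s)%N ->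
  (forall h, h \in s -> H h) -> \prod_(h <- s) h * y = 0.
Proof.
elim/last_ind: s p y => [|s h IH] p y.
  by rewrite leqn0 => hy /eqP p0; move: hy; rewrite p0 => /= ->; rewrite mulr0.
rewrite size_rcons -cats1 big_cat big_seq1 -mulrA => hy ps hs.
apply: (IH p.-1); last by move=> k ks; apply: hs; rewrite mem_cat ks.
  case: p {ps} hy => [/= ->|p hy]; first by rewrite mulr0.
  by apply: hy; apply: hs; rewrite mem_cat inE eqxx orbT.
by case: p {hy} ps.
Qed.

Definition ad_word (s : seq A) (z : A) : A := foldr bracket z s.

(* Expanding the commutators, each term has N factors from H on one side of z. *)
Lemma ad_word_sandwich H N (s l r : seq A) z : ann H N 1 ->
  (forall h, h \in l ++ s ++ r -> H h) -> (N + N <= size (l ++ s ++ r))%N ->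
  \prod_(h <- l) h * ad_word s z * \prod_(h <- r) h = 0.
Proof.
move=> hN; have prod0 t : (N <= size t)%N -> (forall h, h \in t -> H h) ->
    \prod_(h <- t) h = 0 by move=> Nt ht; rewrite -[LHS]mulr1 (ann_prod hN Nt ht).
elim: s l r => [|h s IH] l r.
  rewrite cat0s => hs hsize; have [Nl|lN] := leqP N (size l).
    by rewrite prod0 ?mul0r // => h hl; apply: hs; rewrite mem_cat hl.
  rewrite (prod0 r) ?mulr0 //; last by move=> h hr; apply: hs; rewrite mem_cat hr orbT.
  by rewrite -(leq_add2l N) (leq_trans hsize) // size_cat leq_add2r ltnW.
move=> hs hsize; rewrite /= /bracket mulrBr mulrBl.
have := IH (rcons l h) r; rewrite cat_rcons -cats1 big_cat big_seq1 !mulrA => -> //.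
have -> : \prod_(h0 <- l) h0 * foldr bracket z s * h * \prod_(h0 <- r) h0 =
    \prod_(h0 <- l) h0 * ad_word s z * \prod_(h0 <- h :: r) h0.
  by rewrite big_cons !mulrA.
rewrite IH ?subrr // => [k|].
  by move=> kin; apply: hs; move: kin; rewrite !(mem_cat, inE) (orbCA (k \in s)) !orbA.
by rewrite (leq_trans hsize) // !size_cat /= addnS.
Qed.

Lemma ad_word0 H N (s : seq A) z : ann H N 1 ->
  (forall h, h \in s -> H h) -> (N + N <= size s)%N -> ad_word s z = 0.
Proof.
move=> hN hs Ns; have := @ad_word_sandwich H N s [::] [::] z hN.
by rewrite !big_nil mul1r mulr1 cat0s cats0; exact.
Qed.

(** The spaces [ann H p] form a filtration stable under [x]. On each layer [H] acts by zero and
    [x ^+ m] vanishes, so [m] factors from [H'] descend one level and [N] levels cost [N * m]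
    factors. *)
Lemma ann_extend H H' N m x : (forall h, H h -> H (bracket h x)) -> x ^+ m = 0 ->
  (forall y, H' y -> exists h c, H h /\ y = h + c *: x) ->
  ann H N 1 -> ann H' (N * m) 1.
Proof.
move=> nx xm sH'; elim: N 1 => [//|p IH] y hy.
rewrite mulSn.
(* Here [i] counts the factors from [H'] that suffice to reach level [p]; it starts at [m] because
   [x ^+ m = 0]. *)
suff claim i z : ann H p.+1 z -> ann H p (x ^+ i * z) -> ann H' (i + p * m) z.
  by apply: claim => //; rewrite xm mul0r; exact: ann0.
elim: i z => [|i IHi] {hy}y hy hxy; first by apply: IH; rewrite -[y]mul1r -(expr0 x).
move=> _ /sH' [h [c [Hh ->]]].
have hhy : ann H p (h * y) by exact: hy.
rewrite mulrDl -scalerAl; apply: IHi.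
  by apply: annD; [exact: annS|apply: annZ; exact: ann_norm].
rewrite mulrDr -scalerAr [_ * (x * y)]mulrA -exprSr; apply: annD; [|exact: annZ].
exact: ann_iter.
Qed.

Variable L : set A.
Hypothesis L0 : L 0.
Hypothesis L_linear : forall c x y, L x -> L y -> L (c *: x + y).
Hypothesis L_bracket : forall x y, L x -> L y -> L (bracket x y).
Hypothesis L_nil : forall x, L x -> exists m, x ^+ m = 0.

(** Otherwise, starting from [z], brackets with suitable elements of [H] could be iterated forever
    without entering [H], whereas [N + N] of them give 0. *)
Lemma engel_normalizer H N z : H `<=` L -> H 0 -> ann H N 1 -> L z -> ~ H z ->
  exists x, [/\ L x, ~ H x & forall h, H h -> H (bracket h x)].
Proof.
move=> HL H0 hN Lz nHz; apply: contrapT => no.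
have step x : L x -> ~ H x -> exists h, H h /\ ~ H (bracket h x).
  move=> Lx nHx; apply: contrapT => noh; apply: no; exists x; split=> // h Hh.
  by apply: contrapT => nb; apply: noh; exists h.
have long k : exists s, [/\ size s = k, forall h, h \in s -> H h &
    L (ad_word s z) /\ ~ H (ad_word s z)].
  elim: k => [|k [s [sk sH [Ls nHs]]]]; first by exists [::].
  have [h [Hh nHh]] := step _ Ls nHs; exists (h :: s); split=> /=.
  - by rewrite sk.
  - by move=> h'; rewrite inE => /predU1P[->|/sH].
  - by split=> //; apply: L_bracket => //; exact: HL.
have [s [sk sH [_]]] := long (N + N)%N.
by rewrite (ad_word0 z hN sH) ?sk.
Qed.

Lemma engel_grow (H : {vspace A}) N : (forall x, x \in H -> L x) ->
  (forall x y, x \in H -> y \in H -> bracket x y \in H) ->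
  ann [set` H] N 1 -> ~ L `<=` [set` H] -> exists (H' : {vspace A}) M,
  [/\ (\dim H < \dim H')%N, forall x, x \in H' -> L x,
      forall x y, x \in H' -> y \in H' -> bracket x y \in H'
    & ann [set` H'] M 1].
Proof.
move=> HL Hb hN /existsNP[z /not_implyP[Lz nHz]].
have H0 : [set` H] 0 by exact: mem0v.
have [x [Lx nHx nx]] := engel_normalizer (HL : [set` H] `<=` L) H0 hN Lz nHz.
have [m xm] := L_nil Lx.
have mem y : y \in (H + <[x]>)%VS -> exists h c, h \in H /\ y = h + c *: x.
  by move=> /memv_addP[h Hh [_ /vlineP[c ->] ->]]; exists h, c.
have sub h : h \in H -> h \in (H + <[x]>)%VS by apply/subvP; exact: addvSl.
exists (H + <[x]>)%VS, (N * m)%N; split.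
- rewrite ltn_neqAle dimvS ?addvSl // andbT; apply/negP => /eqP e; apply: nHx => /=.
  have -> : H = (H + <[x]>)%VS by apply/eqP; rewrite eqEdim addvSl e /=.
  by apply: (subvP (addvSr _ _)); exact: memv_line.
- by move=> y /mem[h [c [Hh ->]]]; rewrite addrC; apply: L_linear => //; exact: HL.
- move=> _ _ /mem[h [c [Hh ->]]] /mem[h' [c' [Hh' ->]]]; apply: sub.
  (* The term in [bracket x x] vanishes, so the bracket lands even in [H]. *)
  have -> : bracket (h + c *: x) (h' + c' *: x) =
      bracket h h' + c' *: bracket h x - c *: bracket h' x.
    have E (A1 A2 A3 A4 B1 B3 B2 : A) :
        A1 + A2 + (A3 + A4) - (B1 + B3 + (B2 + A4)) = A1 - B1 + (A2 - B2) - (B3 - A3).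
      rewrite opprB !opprD (addrACA (- B1)) (addrACA (A1 + A2)) (addrACA A1); congr (_ + _).
      by rewrite (addrACA A3) subrr addr0.
    rewrite /bracket !mulrDl !mulrDr -!scalerAl -!scalerAr !scalerBr.
    by rewrite (scalerA c c') (scalerA c' c) (mulrC c') E.
  apply: memvB; last exact/memvZ/nx.
  by apply: memvD; [exact: Hb|exact/memvZ/nx].
- exact: (ann_extend (H := [set` H]) nx xm mem).
Qed.

(** Induction on [k], a bound for the codimension of [H] in the whole algebra: [H] grows until it
    contains [L]. *)
Lemma engel_enlarge k (H : {vspace A}) N : (\dim {:A} <= \dim H + k)%N ->
  (forall x, x \in H -> L x) -> (forall x y, x \in H -> y \in H -> bracket x y \in H) ->
  ann [set` H] N 1 -> exists M, ann L M 1.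
Proof.
elim: k H N => [|k IH] H N dimH HL Hb hN.
  have [LH|nLH] := pselect (L `<=` [set` H]); first by exists N; exact: ann_sub hN.
  have [H' [M [ltH _ _ _]]] := engel_grow HL Hb hN nLH.
  by have := leq_trans (leq_trans ltH (dimvS (subvf _))) dimH; rewrite addn0 ltnn.
have [LH|nLH] := pselect (L `<=` [set` H]); first by exists N; exact: ann_sub hN.
have [H' [M [ltH HL' Hb' hM]]] := engel_grow HL Hb hN nLH.
by apply: (IH H' M) => //; rewrite (leq_trans dimH) // addnS -addSn leq_add2r.
Qed.

Theorem engel : exists N, ann L N 1.
Proof.
apply: (@engel_enlarge (\dim {:A}) 0%VS 1).
- exact: leq_addl.
- by move=> x; rewrite memv0 => /eqP ->.
- by move=> x y; rewrite memv0 => /eqP -> _; rewrite /bracket mul0r mulr0 subrr mem0v.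
- by move=> x /=; rewrite memv0 => /eqP ->; rewrite mul0r.
Qed.

End Engel.

(** * Linearity of the action and orbits of the enveloping algebra *)

Section LieModules.
Variables (K : fieldType) (g : lieType K) (M : lieModType g).

Lemma lactD (x : g) (v w : M) : lact x (v + w) = lact x v + lact x w.
Proof. by have := lact_linearr x 1 v w; rewrite !scale1r. Qed.

Lemma lact0 (x : g) : lact x (0 : M) = 0.
Proof. by apply: (addIr (lact x 0)); rewrite -lactD !add0r. Qed.

Lemma lactZ (x : g) c (v : M) : lact x (c *: v) = c *: lact x v.
Proof. by have := lact_linearr x c v 0; rewrite lact0 !addr0. Qed.

Lemma lact_sum (x : g) (I : Type) (r : seq I) (F : I -> M) :
  lact x (\sum_(i <- r) F i) = \sum_(i <- r) lact x (F i).
Proof. by apply: (big_morph (lact x)); [exact: lactD|exact: lact0]. Qed.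

Lemma lactDl (x y : g) (v : M) : lact (x + y) v = lact x v + lact y v.
Proof. by have := lact_linearl v 1 x y; rewrite /= !scale1r. Qed.

Lemma lact0l (v : M) : lact (0 : g) v = 0.
Proof. by apply: (addIr (lact 0 v)); rewrite -lactDl !add0r. Qed.

Lemma lactZl c (x : g) (v : M) : lact (c *: x) v = c *: lact x v.
Proof. by have := lact_linearl v c x 0; rewrite /= lact0l !addr0. Qed.

Lemma U_orbit_self (w : M) : U_orbit w w.
Proof. by apply: sub_lin_span; exists [::]. Qed.

Lemma U_orbit_lact (w : M) (x : g) v : U_orbit w v -> U_orbit w (lact x v).
Proof.
have [h0 hP] := lin_span_linear [set foldr lact w xs | xs in [set: seq g]].
move: v; apply: lin_span_min.
  split; first by rewrite lact0.
  by move=> c v u hv hu; rewrite lactD lactZ; exact: hP.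
by move=> _ [xs _ <-]; apply: sub_lin_span; exists (x :: xs).
Qed.

Lemma U_orbit_min (w : M) (W : set M) : linear_set W -> W w ->
  (forall x v, W v -> W (lact x v)) -> U_orbit w `<=` W.
Proof.
move=> hW Ww WM; apply: lin_span_min => // _ [xs _ <-].
by elim: xs => //= x xs; exact: WM.
Qed.

End LieModules.

(** * Vectors killed by long products of operators x - mu(x) *)

Section TwistedNilpotence.
Variables (K : fieldType) (N : lieType K) (mu : N -> K).

Section OneModule.
Variable M : lieModType N.
Implicit Types v w : M.

(** With [mu] a bare function, one notion serves twice: [mu = 0] gives nilpotence on g/n, and
    [mu = lambda] the twisted nilpotence on M. *)
Fixpoint lnil (p : nat) v : Prop :=
  if p is p'.+1 then forall x, lnil p' (lact x v - mu x *: v) else v = 0.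

Lemma lnil_succ p v : (forall x, lnil p (lact x v - mu x *: v)) -> lnil p.+1 v.
Proof. by []. Qed.

Lemma lnil_linear p : linear_set (lnil p).
Proof.
elim: p => [|p [h0 hP]]; first by split=> //= c v w -> ->; rewrite scaler0 addr0.
split=> [x|c v w hv hw x] /=; first by rewrite lact0 scaler0 subr0.
have -> : lact x (c *: v + w) - mu x *: (c *: v + w) =
    c *: (lact x v - mu x *: v) + (lact x w - mu x *: w).
  by rewrite lactD lactZ scalerDr opprD addrACA scalerBr !scalerA (mulrC c).
exact: hP.
Qed.

Lemma lnilS p v : lnil p v -> lnil p.+1 v.
Proof.
elim: p v => [|p IH] v; first by move=> /= -> x; rewrite lact0 scaler0 subr0.
by move=> hv x; apply: IH; exact: hv.
Qed.

Lemma lnil_le p q v : (p <= q)%N -> lnil p v -> lnil q v.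
Proof. by move=> /subnK <-; elim: (q - p)%N => // k IH /IH; exact: lnilS. Qed.

Lemma lnil_lact p x v : lnil p v -> lnil p (lact x v).
Proof.
move=> hv; rewrite -[lact x v](subrK (mu x *: v)).
apply: linear_setD; [exact: lnil_linear|exact: (lnilS hv)|].
by apply: linear_setZ => //; exact: lnil_linear.
Qed.

(** Keep applying some operator x - mu(x) that does not kill the current vector. This never leaves
    [S], and after fewer than [p] steps no such operator is left. *)
Lemma lnil_eigenvector p v (S : submod M) : lnil p v -> v != 0 -> (S : set M) v ->
  exists u, [/\ (S : set M) u, u != 0 & forall x, lact x u = mu x *: u].
Proof.
elim: p v => [|p IH] v; first by move=> /= ->; rewrite eqxx.
move=> hv v0 Sv; have [e|/existsNP[x /eqP nx]] := pselect (forall x, lact x v = mu x *: v).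
  by exists v.
apply: (IH (lact x v - mu x *: v)) => //; first by rewrite subr_eq0.
rewrite addrC -scaleNr; apply: submodP => //; exact: submod_lact.
Qed.

End OneModule.

Lemma lnil_submod (M : lieModType N) (S : submod M) p (v : submodType S) :
  lnil p (val v) -> lnil p v.
Proof.
elim: p v => [|p IH] v /=; first by move=> v0; apply: val_inj.
by move=> hv x; apply: IH; exact: hv.
Qed.

Lemma lnil_quot (M : lieModType N) (S : submod M) p (v : M) :
  lnil p v -> lnil p (toQuot S v).
Proof.
elim: p v => [|p IH] v /=; first by move=> ->; rewrite -(subrr (0 : M)) toQuotB subrr.
by move=> hv x; rewrite -toQuot_lact -toQuotZ -toQuotB; exact: IH.
Qed.

End TwistedNilpotence.

(** * Uniform nilpotence on locally nilpotent modules *)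

Section LocallyNilpotent.
Variables (K : fieldType) (N : lieType K) (M : lieModType N).

(** On a finite basis of the orbit of [w] the algebra acts by matrices. These are nilpotent and
    closed under commutators, so Engel's theorem makes all long products of them vanish. *)
Lemma locally_nilpotent_lnil (w : M) : locally_nilpotent M ->
  exists p, lnil (fun=> 0) p w.
Proof.
case=> lf ln; have [B [Bf BE] /finite_seqP[s0 Bs0]] := lf w.
have {B Bs0 Bf BE}[s [us sf sE]] : exists s : seq M,
    [/\ uniq s, lin_free [set` s] & lin_span [set` s] = U_orbit w].
  exists (undup s0); rewrite undup_uniq.
  suff -> : [set` undup s0] = B by [].
  by rewrite Bs0; apply/seteqP; split=> x /=; rewrite mem_undup.
have sx (x : N) v : lin_span [set` s] v -> lin_span [set` s] (lact x v).
  by rewrite sE; exact: U_orbit_lact.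
have : lin_span [set` s] w by rewrite sE; exact: U_orbit_self.
move=> /lin_span_seq_coord.
(* Square matrices form a nonzero ring only in positive size, so the empty basis, where [w = 0], is
   treated apart. *)
case Ed: (size s) => [|d] [c0 wE].
  by exists 0%N; rewrite /= wE big_ord0.
pose phi (c : 'cV[K]_d.+1) := \sum_i c i 0 *: s`_i.
have phiP k c e : phi (k *: c + e) = k *: phi c + phi e.
  rewrite /phi scaler_sumr -big_split; apply: eq_bigr => i _ /=.
  by rewrite !mxE scalerDl scalerA.
have phiB c e : phi (c - e) = phi c - phi e.
  by rewrite addrC -scaleN1r phiP scaleN1r addrC.
have phi0 : phi 0 = 0 by rewrite -(subrr 0) phiB subrr.
have sM (j : 'I_d.+1) : s`_j \in s by rewrite mem_nth // Ed.
have phi_inj c e : phi c = phi e -> c = e.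
  move=> /eqP; rewrite -subr_eq0 -phiB => /eqP h.
  apply/colP => i; apply/eqP; rewrite -subr_eq0; apply/eqP.
  (* [lin_free] wants coefficients as a function of the vector, so each coordinate is looked up by
     the position of its vector in [s]. *)
  have := sf s (fun x => (c - e) (inord (index x s)) 0) us (fun x xs => xs) _ _ (sM i).
  rewrite index_uniq ?Ed // inord_val !mxE; apply.
  apply: etrans h; rewrite (big_nth 0) Ed big_mkord; apply: eq_bigr => j _.
  by rewrite index_uniq ?Ed // inord_val.
pose rep x (A : 'M[K]_d.+1) := forall c, lact x (phi c) = phi (A *m c).
pose L : set 'M[K]_d.+1 := [set A | exists x, rep x A].
have rep_ex x : exists A, rep x A.
  have h (j : 'I_d.+1) : exists c, lact x s`_j = phi c.
    have /lin_span_seq_coord : lin_span [set` s] (lact x s`_j).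
      by apply: sx; apply: sub_lin_span; exact: sM.
    by rewrite Ed.
  have [f fP] := choice h; exists (\matrix_(i, j) f j i 0) => c.
  rewrite lact_sum.
  under eq_bigr => j _ do rewrite lactZ fP scaler_sumr.
  rewrite exchange_big; apply: eq_bigr => i _ /=.
  rewrite mxE scaler_suml; apply: eq_bigr => j _; rewrite mxE scalerA.
  by rewrite mulrC.
have iterP x A m c : rep x A -> iter m (lact x) (phi c) = phi (A ^+ m *m c).
  move=> xA; elim: m => [|m IH]; first by rewrite expr0 mul1mx.
  by rewrite iterS IH xA mulmxA exprS.
have [||||P hP] := @engel K _ L.
- by exists 0 => c; rewrite lact0l mul0mx phi0.
- move=> k A A' [x xA] [y yA]; exists (k *: x + y) => c.
  by rewrite lactDl lactZl xA yA -phiP mulmxDl scalemxAl.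
- move=> A A' [x xA] [y yA]; exists (lie x y) => c.
  by rewrite lact_lie xA yA xA yA -phiB /bracket mulmxBl !mulmxA.
- move=> A [x xA].
  have [f fP] := choice (fun j : 'I_d.+1 => ln x s`_j).
  (* An exponent that works for all basis vectors at once kills every column. *)
  exists (\max_j f j)%N; apply/matrixP => i j; rewrite [RHS]mxE.
  have : phi (A ^+ (\max_j f j) *m delta_mx j 0) = phi 0.
    rewrite -(iterP x) // phi0.
    have -> : phi (delta_mx j 0) = s`_j.
      rewrite /phi (bigD1 j) //= big1 => [|k /negPf nk]; rewrite mxE.
        by rewrite !eqxx scale1r addr0.
      by rewrite nk scale0r.
    by apply: fP; exact: leq_bigmax.
  by move=> /phi_inj /matrixP /(_ i 0); rewrite -colE !mxE.
suff claim q Y : ann L q Y -> lnil (fun=> 0) q (phi (Y *m c0)).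
  by exists P; rewrite wE -/(phi c0) -[c0]mul1mx; exact: claim.
elim: q Y => [|q IH] Y hY; first by rewrite /= hY mul0mx phi0.
move=> x; rewrite scale0r subr0; have [A xA] := rep_ex x.
by rewrite xA mulmxA; apply: IH; apply: hY; exists x.
Qed.

End LocallyNilpotent.

(** * Modules generated by one eigenvector of n *)

Section WhittakerGenerated.
Variables (K : fieldType) (g : lieType K) (n : lieSub g).
Local Notation N := (lieSubType n).
Local Notation quot_n := (quotMod (adj_sub n)).
Local Notation toQ y := (@toQuot K N (resMod n (adjMod g)) (adj_sub n) y).
Variables (M : lieModType g) (mu : N -> K).

Lemma toQuot_adjP (y : g) : toQ y = 0 <-> (n : set g) y.
Proof.
rewrite -(subrr (toQ 0)) -toQuotB subrr.
by have := toQuotP (adj_sub n) y 0; rewrite subr0.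
Qed.

Lemma toQuot_adj_lie (x : N) (y : g) : lact x (toQ y) = toQ (lie (val x) y).
Proof. by rewrite -toQuot_lact. Qed.

Lemma lact_swap (x y : g) (v : M) : lact x (lact y v) = lact (lie x y) v + lact y (lact x v).
Proof. by rewrite lact_lie subrK. Qed.

(** In [(x - mu x) y v = [x, y] v + y (x - mu x) v] the first term lowers the level of [y] in g/n
    and the second that of [v]. At [q = 0], [y] lies in n and preserves the level of [v]. *)
Lemma lnil_lact_adj q p (y : g) (v : resMod n M) :
  lnil (fun=> 0) q (toQ y) -> lnil mu p v ->
  lnil mu (p + q) (lact y (v : M) : resMod n M).
Proof.
elim: q y p v => [|q IHq] y p v.
  rewrite addn0 => /toQuot_adjP ny; exact: (lnil_lact (exist _ y (mem_set ny) : N)).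
elim: p v => [|p IHp] v hy hv.
  by rewrite (hv : v = 0) lact0; apply: (proj1 (lnil_linear _ _ _)).
rewrite addSn; apply: lnil_succ => x.
have -> : lact x (lact y (v : M) : resMod n M) - mu x *: (lact y (v : M) : resMod n M) =
    (lact (lie (val x) y) (v : M) : resMod n M) +
    (lact y ((lact x v - mu x *: v) : M) : resMod n M).
  by rewrite lactBr lactZ addrA -lact_swap.
apply: linear_setD; first exact: lnil_linear.
  rewrite -addSnnS; apply: IHq => //.
  by rewrite -toQuot_adj_lie; have := hy x; rewrite scale0r subr0.
by apply: IHp => //; exact: hv.
Qed.

(** Local finiteness phrased by spanning lists, which can be concatenated and enlarged freely; a
    basis is extracted only in [finite_gen_fin_dim]. *)
Definition finite_gen (v : resMod n M) : Prop := exists s : seq (resMod n M),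
  lin_span [set` s] v /\
  forall (x : N) w, lin_span [set` s] w -> lin_span [set` s] (lact x w).

Lemma finite_gen_fin_dim v : finite_gen v -> fin_dim (U_orbit v).
Proof.
move=> [s [sv sx]]; apply: (@linear_set_fin_dim _ _ s).
  exact: lin_span_linear.
by apply: U_orbit_min => //; exact: lin_span_linear.
Qed.

Lemma finite_gen_linear : linear_set finite_gen.
Proof.
split.
  exists [::]; split; first exact: (proj1 (lin_span_linear _)).
  have z w : lin_span [set` [::]] w -> w = 0 :> resMod n M.
    by move=> /lin_span_seq_coord[c ->]; rewrite big_ord0.
  by move=> x w /z ->; rewrite lact0; exact: (proj1 (lin_span_linear _)).
move=> c v w [s [sv sx]] [t [tw tx]]; exists (s ++ t).
have sS : [set` s] `<=` [set` s ++ t] by move=> y /= ys; rewrite mem_cat ys.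
have tS : [set` t] `<=` [set` s ++ t] by move=> y /= ys; rewrite mem_cat ys orbT.
split.
  apply: (proj2 (lin_span_linear _)); first exact: lin_span_sub sv.
  exact: lin_span_sub tw.
move=> x; apply: lin_span_min.
  have [h0 hP] := lin_span_linear [set` s ++ t].
  by split=> [|k u u' hu hu']; rewrite ?lact0 // lactD lactZ; exact: hP.
move=> y /=; rewrite mem_cat => /orP[ys|yt].
  by apply: lin_span_sub (sS) _ _; apply/sx/sub_lin_span.
by apply: lin_span_sub (tS) _ _; apply/tx/sub_lin_span.
Qed.

(** Let E be the span of [s], and T the set of lifts to g of a basis of the orbit of the class of
    [y] in g/n. Then E + T E is n-stable and contains [y v]. *)
Lemma finite_gen_lact (y : g) (v : resMod n M) : locally_finite quot_n ->
  finite_gen v -> finite_gen (lact y (v : M)).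
Proof.
move=> lf [s [sv sx]]; have [B [_ BE] /finite_seqP[tq tqE]] := lf (toQ y).
rewrite {B}tqE in BE.
pose t : seq g := [seq (repr z : g) | z <- tq].
pose r : seq (resMod n M) := s ++ [seq lact z (u : M) | z <- t, u <- s].
have [r0 rP] := lin_span_linear [set` r].
have sr w : lin_span [set` s] w -> lin_span [set` r] w.
  by apply: lin_span_sub => u /= us; rewrite mem_cat us.
have lin_r z : linear_set [set w : resMod n M | lin_span [set` r] (lact z (w : M))].
  by split=> [|k u u' hu hu'] /=; rewrite ?lact0 // lactD lactZ; exact: rP.
(* r suffices because n maps span s into itself *)
have key z w : lin_span [set` tq] (toQ z) -> lin_span [set` s] w ->
    lin_span [set` r] (lact z (w : M)).
  move=> tz sw.
  have [u [nu]] : exists u : g, (n : set g) (z - u) /\ lin_span [set` r] (lact u (w : M)).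
    suff : [set q : quot_n | exists u : g, toQ u = q /\
        lin_span [set` r] (lact u (w : M))] (toQ z).
      move=> [u [e h]]; exists u; split=> //; apply/toQuot_adjP.
      by rewrite toQuotB e subrr.
    move: (toQ z) tz; apply: lin_span_min.
      split; first by exists 0; rewrite lact0l; split=> //; apply/toQuot_adjP; exact: lieSub0.
      move=> c _ _ [u [<- hu]] [u' [<- hu']]; exists (c *: u + u').
      by rewrite lactDl lactZl toQuotD toQuotZ; split=> //; exact: rP.
    move=> q tqq; exists (repr q : g); split; first exact: toQuotK.
    move: w sw; apply: lin_span_min; first exact: lin_r.
    move=> u us; apply: sub_lin_span; rewrite /= mem_cat; apply/orP; right.
    by apply: allpairs_f => //; apply: map_f.
  move=> ru; rewrite -[z](subrK u) lactDl; apply: linear_setD => //.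
  by apply: sr; exact: (sx (exist _ (z - u) (mem_set nu))).
exists r; split; first by apply: key => //; rewrite BE; exact: U_orbit_self.
move=> x; apply: lin_span_min; first exact: lin_r.
move=> w; rewrite /= mem_cat => /orP[ws|]; first exact/sr/sx/sub_lin_span.
move=> /allpairsP[[z u] /= [/mapP[q tqq ->] us ->]].
(* In [x z u = [x, z] u + z (x u)] the class of [[x, z]] stays in the orbit of the class of [y], and
   [x u] stays in the span of [s]. *)
rewrite /lact /= /res_lact lact_swap; apply: linear_setD => //.
  apply: key; last exact: sub_lin_span.
  rewrite -toQuot_adj_lie toQuotK BE; apply: U_orbit_lact; rewrite -BE.
  exact: sub_lin_span.
apply: key; last exact/sx/sub_lin_span.
by rewrite toQuotK; exact: sub_lin_span.
Qed.

Variable v0 : M.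
Hypothesis v0_eigen : forall x : N, lact (val x) v0 = mu x *: v0.
Hypothesis v0_gen : forall S : submod M, (S : set M) v0 -> S = setT :> set M.
Hypothesis whitt : whittaker_pair n.

(** The vectors admitting such a [p] form a g-submodule containing [v0]: Engel's theorem gives the
    level of each element of g/n, and [lnil_lact_adj] adds the levels. *)
Lemma generated_lnil (v : resMod n M) : exists p, lnil mu p v.
Proof.
pose T : set M := [set v | exists p, lnil mu p (v : resMod n M)].
have T0 : T 0 by exists 0%N.
have TP c u w : T u -> T w -> T (c *: u + w).
  move=> [p hp] [q hq]; exists (p + q)%N; apply: (proj2 (lnil_linear mu _ _)).
    by apply: lnil_le hp; exact: leq_addr.
  by apply: lnil_le hq; exact: leq_addl.
have Tg (x : g) u : T u -> T (lact x u).
  move=> [p hp]; have [q hq] := locally_nilpotent_lnil (toQ x) (proj2 whitt).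
  by exists (p + q)%N; exact: lnil_lact_adj.
have := v0_gen (S := Submod T0 TP Tg).
have T1 : T v0 by exists 1%N => x; apply/eqP; rewrite subr_eq0; apply/eqP; exact: v0_eigen.
by move=> /(_ T1) /= e; have : [set: M] v by []; rewrite -e.
Qed.

Lemma generated_locally_finite : whittaker_module n M.
Proof.
move=> v; apply: finite_gen_fin_dim.
have [F0 FP] := finite_gen_linear.
have Fg (x : g) u : finite_gen u -> finite_gen (lact x (u : M)).
  by apply: finite_gen_lact; exact: (proj1 (proj2 whitt)).
have := v0_gen (S := @Submod K g M finite_gen F0 FP Fg).
have F1 : finite_gen v0.
  exists [:: v0 : resMod n M]; split; first by apply: sub_lin_span; rewrite /= mem_head.
  have [h0 hP] := lin_span_linear [set` [:: v0 : resMod n M]].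
  move=> x; apply: lin_span_min.
    by split=> [|k u u' hu hu'] /=; rewrite ?lact0 // lactD lactZ; exact: hP.
  move=> w /=; rewrite inE => /eqP ->.
  rewrite -[lact _ _]/(lact (val x) v0) v0_eigen.
  by apply: linear_setZ => //; apply: sub_lin_span; rewrite /= mem_head.
by move=> /(_ F1) /= e; have : [set: M] v by []; rewrite -e.
Qed.

End WhittakerGenerated.

(** * Isomorphism of modules as an equivalence *)

Section Isomorphisms.
Variables (K : fieldType) (g : lieType K).
Implicit Types M N P : lieModType g.

Lemma lie_mod_iso_trans M N P : lie_mod_iso M N -> lie_mod_iso N P -> lie_mod_iso M P.
Proof.
move=> [f fb fl] [h hb hl]; exists (h \o f : {linear M -> P}) => /=.
  exact: bij_comp.
by move=> x v /=; rewrite fl hl.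
Qed.

Lemma lie_mod_iso_sym M N : lie_mod_iso M N -> lie_mod_iso N M.
Proof.
move=> [f [h fK hK] fl].
have hlin : linear h.
  by move=> c u v; apply: (can_inj fK); rewrite linearP !hK.
pose hl := GRing.isLinear.Build K N M *:%R h hlin.
pose H : {linear N -> M} := HB.pack h hl.
exists H; first by exists f.
by move=> x v; apply: (can_inj fK); rewrite /= fl !hK.
Qed.

End Isomorphisms.

(** * Simple modules with twisted nilpotent action *)

Section SimpleNilpotent.
Variables (K : fieldType) (N : lieType K) (lambda : lieHom N K^o).
Local Notation mu := (fun x => lambda x : K).

(** Nilpotence yields a common eigenvector; its line is a submodule, hence all of [Q]. *)
Lemma simple_lnil_iso (Q : lieModType N) : simple_module Q ->
  (forall v : Q, exists p, lnil mu p v) -> lie_mod_iso Q (charMod lambda).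
Proof.
move=> [[v v0] Qs] Qnil; have [p hp] := Qnil v.
pose T : submod Q := @Submod K N Q setT I (fun _ _ _ _ _ => I) (fun _ _ _ => I).
have [u [_ u0 uE]] := lnil_eigenvector (S := T) hp v0 I.
pose S := [set w : Q | exists c : K, w = c *: u].
have S0 : S 0 by exists 0; rewrite scale0r.
have SP c w w' : S w -> S w' -> S (c *: w + w').
  by move=> [d ->] [d' ->]; exists (c * d + d'); rewrite scalerA scalerDl.
have Sx (x : N) w : S w -> S (lact x w).
  by move=> [d ->]; exists (d * mu x); rewrite lactZ uE scalerA.
have ST w : exists c : K, w = c *: u.
  have [/= e|/= e] := Qs (Submod S0 SP Sx); last first.
    by have : [set: Q] w by []; rewrite -e.
  have : S u by exists 1; rewrite scale1r.
  by rewrite e /= => /eqP; rewrite (negPf u0).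
apply: lie_mod_iso_sym.
pose f (c : charMod lambda) : Q := (c : K) *: u.
have flin : linear f by move=> c d e; rewrite /f scalerDl scalerA.
pose fl := GRing.isLinear.Build K (charMod lambda) Q *:%R f flin.
pose F : {linear charMod lambda -> Q} := HB.pack f fl.
have [h hP] := choice ST.
exists F.
  exists h => [c|w]; last by rewrite /= /f -hP.
  apply/eqP; rewrite -subr_eq0; have /eqP := hP (F c).
  rewrite eq_sym -subr_eq0 -scalerBl scaler_eq0 (negPf u0) orbF; exact.
by move=> x c; rewrite /= /f lactZ uE scalerA mulrC.
Qed.

End SimpleNilpotent.

(** * The dual of the enveloping algebra, by words *)

Section EnvelopingDual.
Variables (K : fieldType) (N : lieType K).

(* Linear forms on U(N), seen as functions of words; the head of a list is the
   last letter of the word. *)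
Record env_form (f : seq N -> K^o) : Prop := EnvForm {
  env_linear : forall u w c x y,
    f (u ++ (c *: x + y) :: w) = c * f (u ++ x :: w) + f (u ++ y :: w);
  env_lie : forall u w x y,
    f (u ++ x :: y :: w) = f (u ++ y :: x :: w) + f (u ++ lie y x :: w)
}.

Definition env_pred : {pred seq N -> K^o} := fun f => `[< env_form f >].

Fact env_submod_closed : submod_closed env_pred.
Proof.
split=> [|c f g /asboolP [f1 f2] /asboolP [g1 g2]]; apply/asboolP; split.
- by move=> * /=; rewrite mulr0 addr0.
- by move=> * /=; rewrite addr0.
- move=> u w d x y /=; rewrite /GRing.add /= /GRing.scale /= f1 g1.
  rewrite -[LHS]/(c * _ + _) -[RHS]/(d * (c * _ + _) + (c * _ + _)).
  by rewrite !mulrDr addrACA !mulrA (mulrC c d).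
- move=> u w x y; rewrite -[LHS]/(c * _ + _) -[RHS]/((c * _ + _) + (c * _ + _)).
  by rewrite f2 g2 mulrDr addrACA.
Qed.

HB.instance Definition _ :=
  GRing.isSubmodClosed.Build K (seq N -> K^o) env_pred env_submod_closed.

End EnvelopingDual.

(** * Bracket identities *)

Section LieExtra.
Variables (K : fieldType) (g : lieType K).

Lemma lieNl (x y : g) : lie (- x) y = - lie x y.
Proof. by rewrite lieC lieNr -lieC. Qed.

Lemma lieBl (x y z : g) : lie (x - y) z = lie x z - lie y z.
Proof. by rewrite lieDl lieNl. Qed.

Lemma lieBr (x y z : g) : lie x (y - z) = lie x y - lie x z.
Proof. by rewrite lieDr lieNr. Qed.

Lemma lie_lie (x y z : g) : lie (lie x y) z = lie x (lie y z) - lie y (lie x z).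
Proof. exact: (@adj_lact_lie K g x y z). Qed.

End LieExtra.

(** * The coinduced module and its Whittaker vectors *)

Section Coinduced.
Variables (K : fieldType) (g : lieType K) (n a : lieSub g).
Hypothesis ds : direct_sum a n.
Local Notation N := (lieSubType n).

Lemma complement_proj_ex (y : g) : exists u : N, (a : set g) (y - val u).
Proof.
have : [set: g] y by [].
rewrite -(proj2 ds) => -[u au [v nv <-]].
by exists (exist _ v (mem_set nv)); rewrite /= addrK.
Qed.

Definition complement_proj (y : g) : N := projT1 (cid (complement_proj_ex y)).
Local Notation pi := complement_proj.

Lemma complement_projP y : (a : set g) (y - val (pi y)).
Proof. by rewrite /complement_proj; case: cid. Qed.

Lemma complement_proj_eq y u : (a : set g) (y - val u) -> pi y = u.
Proof.
move=> h; apply/val_inj/eqP; rewrite -subr_eq0; apply/eqP.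
suff: ((a : set g) `&` n) (val (pi y) - val u) by rewrite (proj1 ds).
split; last first.
  by rewrite -scaleN1r addrC; apply: lieSubP; apply/set_mem/valP.
have := lieSubP (-1) (complement_projP y) h.
by rewrite scaleN1r opprB addrA subrK.
Qed.

Lemma complement_projP_linear c y z : pi (c *: y + z) = c *: pi y + pi z.
Proof.
apply: complement_proj_eq; rewrite [\val _]linearP opprD addrACA -scalerBr.
by apply: lieSubP; apply: complement_projP.
Qed.

HB.instance Definition _ :=
  GRing.isLinear.Build K g N *:%R complement_proj complement_projP_linear.

Lemma complement_projK (x : N) : pi (val x) = x.
Proof. by apply: complement_proj_eq; rewrite subrr; apply: lieSub0. Qed.

(** The bracket of [y - pi y] and [z - pi z] lies in the subalgebra [a], so [pi] kills it; expanding
    it gives the formula. *)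
Lemma complement_proj_lie y z :
  pi (lie y z) = pi (lie (val (pi y)) z) - pi (lie (val (pi z)) y) + lie (pi z) (pi y).
Proof.
have pi0 u : (a : set g) u -> pi u = 0.
  by move=> au; apply: complement_proj_eq; rewrite subr0.
have := pi0 _ (lieSub_lie (complement_projP y) (complement_projP z)).
rewrite lieBl !lieBr opprB !raddfD !raddfN /=.
rewrite -[lie (val (pi y)) (val (pi z))]/(val (lie (pi y) (pi z))) complement_projK.
rewrite (lieC (pi z)) (lieC (val (pi z))) raddfN /= opprK.
move=> /eqP h; apply/eqP; rewrite -subr_eq0; move: h.
rewrite !opprD opprK !addrA => h.
suff -> : forall A B C D : N, A - B - C + D = A - C + D - B by exact: h.
by move=> A B C D; rewrite -!addrA; congr (_ + _); rewrite addrC -addrA.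
Qed.

(* [coind_fun y f w] is [f] at [w y], where in U(N) = K (x)_{U(a)} U(g) one has
   [1 y = pi y] and [w x y = w [x, y] + (w y) x]. *)
Fixpoint coind_fun (y : g) (f : seq N -> K^o) (w : seq N) : K^o :=
  if w is x :: w' then
    coind_fun (lie (val x) y) f w' + coind_fun y (fun u => f (x :: u)) w'
  else f [:: pi y].

Lemma env_form_cons (f : seq N -> K^o) x : env_form f -> env_form (fun u => f (x :: u)).
Proof. by case=> f1 f2; split=> u w *; [exact: (f1 (x :: u))|exact: (f2 (x :: u))]. Qed.

Lemma coind_fun_linearr y c f1 f2 w :
  coind_fun y (fun u => c * f1 u + f2 u) w = c * coind_fun y f1 w + coind_fun y f2 w.
Proof.
elim: w y f1 f2 => [//|x w IH] y f1 f2 /=.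
by rewrite !IH mulrDr addrACA.
Qed.

Lemma coind_fun_linearl c y z f w : env_form f ->
  coind_fun (c *: y + z) f w = c * coind_fun y f w + coind_fun z f w.
Proof.
elim: w y z f => [|x w IH] y z f ff /=; first by rewrite linearP (env_linear ff [::]).
by rewrite lie_linearr !IH ?mulrDr 1?addrACA //; exact: env_form_cons.
Qed.

Lemma coind_funD y z f w : env_form f ->
  coind_fun (y + z) f w = coind_fun y f w + coind_fun z f w.
Proof. by move=> /(coind_fun_linearl 1 y z w); rewrite scale1r mul1r. Qed.

Lemma coind_fun_addr y f1 f2 w :
  coind_fun y (fun u => f1 u + f2 u) w = coind_fun y f1 w + coind_fun y f2 w.
Proof.
rewrite -[X in _ = X + _]mul1r -coind_fun_linearr; congr coind_fun.
by apply/funext => u; rewrite mul1r.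
Qed.

Lemma coind_funB y z f w : env_form f ->
  coind_fun (y - z) f w = coind_fun y f w - coind_fun z f w.
Proof.
by move=> /(coind_fun_linearl (-1) z y w); rewrite scaleN1r mulN1r addrC => ->; rewrite addrC.
Qed.

(** Both relations pass through the letters of the prefix [u] by induction. At empty [u] the
    commutation relation follows from that of [f] and the Jacobi identity. *)
Lemma coind_fun_form y f : env_form f -> env_form (coind_fun y f).
Proof.
move=> ff; split=> u.
  elim: u y f ff => [|z u IH] y f ff w c x x' /=; last first.
    by rewrite !IH ?mulrDr 1?addrACA //; exact: env_form_cons.
  rewrite lie_linearl coind_fun_linearl // mulrDr addrACA -coind_fun_linearr.
  by congr (_ + _); congr coind_fun; apply/funext => u; rewrite (env_linear ff [::]).
elim: u y f ff => [|z u IH] y f ff w x x' /=; last first.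
  by rewrite (IH (lie (val z) y) f ff) (IH y _ (env_form_cons z ff)) addrACA.
have -> : (fun u => f (x :: x' :: u)) = (fun u => f (x' :: x :: u) + f (lie x' x :: u)).
  by apply/funext => u; rewrite (env_lie ff [::]).
rewrite coind_fun_addr [in RHS]lie_lie coind_funB //.
have E (a1 a2 a3 a4 a5 b1 : K) :
  a1 + a2 + (a3 + (a4 + a5)) = b1 + a3 + (a2 + a4) + (a1 - b1 + a5) by ring.
exact: E.
Qed.

(** For an element of n the recursion unwinds by the commutation relation of [f], so n acts by right
    multiplication on words. Eigenvectors of n can then be read off letter by letter. *)
Lemma coind_fun_val (x : N) f : env_form f -> coind_fun (val x) f = fun w => f (x :: w).
Proof.
move=> ff; apply/funext => w; elim: w x f ff => [|z w IH] x f ff /=.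
  by rewrite complement_projK.
have := IH (lie z x) f ff; rewrite /= => ->.
by rewrite (IH _ _ (env_form_cons z ff)) addrC [RHS](env_lie ff [::]).
Qed.

(** Induction on the word. The empty word is [complement_proj_lie] with the commutation relation of
    [f]; each further letter is the Jacobi identity. *)
Lemma coind_fun_lie y z f w : env_form f ->
  coind_fun (lie y z) f w = coind_fun y (coind_fun z f) w - coind_fun z (coind_fun y f) w.
Proof.
elim: w y z f => [|x w IH] y z f ff.
  have f1 x x' : f [:: x + x'] = f [:: x] + f [:: x'].
    by have := env_linear ff [::] [::] 1 x x'; rewrite scale1r mul1r.
  have fN x : f [:: - x] = - f [:: x].
    have f0 : f [:: 0] = 0 by apply: (addIr (f [:: 0])); rewrite -f1 !add0r.
    by apply/eqP; rewrite -addr_eq0 -f1 addNr f0.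
  rewrite /= complement_proj_lie !f1 !fN.
  rewrite [f [:: pi y; pi z]](env_lie ff [::]) /=.
  have E (p q r t : K) : p - q + r = p + (t + r) - (q + t) by ring.
  exact: E.
have ffx := env_form_cons x ff.
rewrite [LHS]/=.
have -> : lie (sval x) (lie y z) = lie (lie (sval x) y) z + lie y (lie (sval x) z).
  by rewrite lie_lie subrK.
rewrite coind_funD; last exact: ff.
rewrite !(IH _ _ _ ff) (IH _ _ _ ffx).
rewrite /= !coind_fun_addr.
have E (p1 p2 p3 q1 q2 q3 : K) :
  p1 - q2 + (p2 - q1) + (p3 - q3) = p1 + (p2 + p3) - (q1 + (q2 + q3)) by ring.
exact: E.
Qed.

(* The underlying space does not depend on [ds]: it is only there to index the
   g-action. *)
Definition coind (_ : direct_sum a n) : Type := {f : seq N -> K^o | @env_pred K N f}.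
HB.instance Definition _ := SubChoice.on (coind ds).
HB.instance Definition _ := [SubChoice_isSubLmodule of (coind ds) by <:].

Lemma coindP (f : coind ds) : env_form (val f).
Proof. exact/asboolP/(valP f). Qed.

Definition coind_lact (y : g) (f : coind ds) : coind ds :=
  exist _ (coind_fun y (val f)) (asboolT (coind_fun_form y (coindP f))).

Fact coind_lact_linearl f : linear (coind_lact^~ f).
Proof.
by move=> c y z; apply/val_inj/funext => w; apply: coind_fun_linearl; exact: coindP.
Qed.
Fact coind_lact_linearr y : linear (coind_lact y).
Proof. by move=> c f1 f2; apply/val_inj/funext => w; exact: coind_fun_linearr. Qed.
Fact coind_lact_lie y z f :
  coind_lact (lie y z) f = coind_lact y (coind_lact z f) - coind_lact z (coind_lact y f).
Proof. by apply/val_inj/funext => w; apply: coind_fun_lie; exact: coindP. Qed.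

HB.instance Definition _ := Lmodule_isLieModule.Build K g (coind ds)
  coind_lact_linearl coind_lact_linearr coind_lact_lie.

Variable lambda : lieHom N K^o.

Definition char_fun (w : seq N) : K^o := \prod_(x <- w) (lambda x : K).

Lemma char_fun_form : env_form char_fun.
Proof.
split=> u w *; rewrite /char_fun !big_cat !big_cons /=.
  rewrite linearP /= [_ *: _]/(_ * _) mulrDl mulrDr; congr (_ + _).
  by rewrite -mulrA mulrCA.
by rewrite lieHom_lie [lie _ _]/(0 : K) mul0r mulr0 addr0 (mulrCA (lambda _)).
Qed.

Definition char_vec : coind ds := exist _ char_fun (asboolT char_fun_form).

Lemma char_vec_neq0 : char_vec != 0.
Proof.
apply/eqP => /(congr1 (fun f : coind ds => val f [::])) /=.
by rewrite /char_fun big_nil => /eqP; rewrite (oner_eq0 K).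
Qed.

Lemma char_vec_whittaker : whittaker_vectors lambda (coind ds) char_vec.
Proof.
move=> x; apply/val_inj; rewrite /= coind_fun_val; last exact: char_fun_form.
by apply/funext => w; rewrite /char_fun big_cons.
Qed.

(** The eigenvector equation at [w] reads [f (x :: w) = lambda x * f w], so the value at the empty
    word determines [f]. *)
Lemma whittaker_coind f : whittaker_vectors lambda (coind ds) f ->
  f = (val f [::] : K) *: char_vec.
Proof.
move=> hf; apply/val_inj/funext; elim=> [|x w IH].
  by rewrite -[RHS]/(val f [::] * char_fun [::]) /char_fun big_nil mulr1.
have := congr1 (fun f : coind ds => val f w) (hf x).
rewrite /= coind_fun_val; last exact: coindP.
move=> ->; rewrite -[LHS]/(lambda x * val f w) IH.
by rewrite -[RHS]/(val f [::] * char_fun (x :: w)) /char_fun big_cons mulrCA.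
Qed.

End Coinduced.

(** * The submodule generated by a vector *)

Section Cyclic.
Variables (K : fieldType) (g : lieType K) (M : lieModType g) (v : M).

Definition gen_set : set M := [set w | forall S : submod M, (S : set M) v -> (S : set M) w].

Fact gen_set0 : gen_set 0.
Proof. by move=> S _; exact: submod0. Qed.
Fact gen_setP c u w : gen_set u -> gen_set w -> gen_set (c *: u + w).
Proof. by move=> hu hw S Sv; apply: submodP; [exact: hu|exact: hw]. Qed.
Fact gen_set_lact (x : g) w : gen_set w -> gen_set (lact x w).
Proof. by move=> hw S Sv; apply: submod_lact; exact: hw. Qed.

Definition gen_submod : submod M := Submod gen_set0 gen_setP gen_set_lact.

Fact gen_vec_subproof : gen_set v. Proof. by []. Qed.
Definition gen_vec : submodType gen_submod :=
  exist _ v (mem_set (gen_vec_subproof : (gen_submod : set M) v)).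

(** The image of [S] in [M] is a submodule containing [v], so it contains all of [gen_set]. *)
Lemma gen_vec_gen (S : submod (submodType gen_submod)) :
  (S : set _) gen_vec -> S = setT :> set _.
Proof.
move=> Sv; pose T : set M := [set u | exists2 w, (S : set _) w & val w = u].
have T0 : T 0 by exists 0 => //; exact: submod0.
have TP c u w : T u -> T w -> T (c *: u + w).
  by move=> [u' Su <-] [w' Sw <-]; exists (c *: u' + w') => //; exact: submodP.
have Tx (x : g) u : T u -> T (lact x u).
  by move=> [u' Su <-]; exists (lact x u') => //; exact: submod_lact.
apply/seteqP; split=> // w _.
have /(_ (Submod T0 TP Tx)) := set_mem (valP w).
by case=> [|w' Sw /val_inj <- //]; exists gen_vec.
Qed.

End Cyclic.

(** * Block, simplicity and Whittaker vectors of a cyclic module *)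

Section CyclicWhittaker.
Variables (K : fieldType) (g : lieType K) (n : lieSub g) (M : lieModType g) (v0 : M).
Variable lambda : lieHom (lieSubType n) K^o.
Hypothesis v0_eigen : whittaker_vectors lambda M v0.
Hypothesis v0_gen : forall S : submod M, (S : set M) v0 -> S = setT :> set M.
Hypothesis whitt : whittaker_pair n.

Lemma cyclic_whittaker_in_block : in_block lambda M.
Proof.
split; first exact: (generated_locally_finite v0_eigen v0_gen whitt).
move=> F _ Q [k [Fs [[_ _ series] [i ik iso]]]].
apply: lie_mod_iso_trans iso _; apply: simple_lnil_iso; first exact: (proj2 (series i ik)).
(* The vector is lifted through the quotient and viewed in [M] through both submodules; nilpotence
   found there descends along the same maps. *)
move=> v; have [p hp] := generated_lnil v0_eigen v0_gen whitt (val (val (repr v))).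
exists p; rewrite -(toQuotK v); apply: lnil_quot; apply: lnil_submod.
exact: lnil_submod.
Qed.

Hypothesis v0_neq0 : v0 != 0.
Hypothesis v0_line : forall u, whittaker_vectors lambda M u -> exists c : K, u = c *: v0.

(** A nonzero submodule contains a nonzero Whittaker vector by nilpotence; this is a multiple of
    [v0], which generates [M]. *)
Lemma cyclic_whittaker_simple : simple_module M.
Proof.
split; first by exists v0.
move=> S; have [S0|/existsNP[v /not_implyP[Sv /= v0N]]] := pselect ((S : set M) `<=` [set 0]).
  by left; apply/seteqP; split=> // _ ->; exact: submod0.
right; apply: v0_gen.
pose T : submod (resMod n M) := @Submod K (lieSubType n) (resMod n M) S
  (submod0 S) (@submodP _ _ _ S) (fun x => @submod_lact _ _ _ S (val x)).
have [p hp] := generated_lnil v0_eigen v0_gen whitt v.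
have vN : (v : resMod n M) != 0 by apply/eqP.
have [u [Su u0 uE]] := lnil_eigenvector (S := T) hp vN Sv.
have [c uc] := v0_line uE.
have c0 : c != 0 by apply: contraNneq u0 => c0; rewrite uc c0 scale0r.
rewrite -[v0]scale1r -(mulVf c0) -scalerA -uc -[_ *: _]addr0.
by apply: submodP => //; exact: submod0.
Qed.

Lemma whittaker_vectors_dim1 : has_dim 1 (whittaker_vectors lambda M).
Proof.
exists [set v0]; last exact: card_set1.
split.
  move=> s c us sv; have s1 x : x \in s -> s = [:: v0].
    move=> xs; have xv := sv _ xs; move: xs; rewrite xv => {x xv}xs.
    apply: perm_small_eq => //; apply: uniq_perm => // y.
    by rewrite inE; apply/idP/eqP => [/sv|->].
  move=> + y ys; rewrite (s1 _ ys) big_seq1 => /eqP.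
  by rewrite scaler_eq0 (negPf v0_neq0) orbF (sv _ ys) => /eqP.
apply/seteqP; split.
  apply: lin_span_min.
    split=> [x|c u w hu hw x]; first by rewrite lact0 scaler0.
    by rewrite lactD lactZ hu hw scalerDr !scalerA mulrC.
  by move=> _ ->; exact: v0_eigen.
move=> u /v0_line[c ->]; apply: linear_setZ; first exact: lin_span_linear.
exact: sub_lin_span.
Qed.

End CyclicWhittaker.

(** * Existence over an arbitrary field, then over the complex numbers *)

Lemma exists_simple_whittaker (K : fieldType) (g : lieType K) (n a : lieSub g)
    (lambda : lieHom (lieSubType n) K^o) : whittaker_pair n -> direct_sum a n ->
  exists M : lieModType g,
    [/\ in_block lambda M, simple_module M & has_dim 1 (whittaker_vectors lambda M)].
Proof.
move=> whitt ds; set f := char_vec ds lambda.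
have f_eigen : whittaker_vectors lambda (submodType (gen_submod f)) (gen_vec f).
  by move=> x; apply/val_inj; exact: (char_vec_whittaker ds lambda x).
have f0 : gen_vec f != 0.
  apply/eqP => /(congr1 val) e; have /negP := char_vec_neq0 ds lambda; apply.
  by apply/eqP; exact: e.
(* Whittaker vectors of the submodule remain so in the coinduced module; the coefficient is the
   value at the empty word. *)
have f_line u : whittaker_vectors lambda (submodType (gen_submod f)) u ->
    exists c : K, u = c *: gen_vec f.
  move=> hu; have h : whittaker_vectors lambda (coind ds) (val u).
    by move=> x; exact: (congr1 val (hu x)).
  by exists (val (val u) [::]); apply/val_inj; exact: (whittaker_coind h).
exists (submodType (gen_submod f)); split.
- exact: (cyclic_whittaker_in_block f_eigen (@gen_vec_gen _ _ _ f) whitt).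
- exact: (cyclic_whittaker_simple f_eigen (@gen_vec_gen _ _ _ f) whitt f0 f_line).
- exact: (whittaker_vectors_dim1 f_eigen f0 f_line).
Qed.

Local Open Scope complex_scope.

Theorem theorem49 (R : realType) (g : lieType R[i]) (n a : lieSub g) :
  countable_dim [set: g] ->
  whittaker_pair n ->
  direct_sum a n ->
  forall lambda : lieHom (lieSubType n) (R[i])^o,
    exists M : lieModType g,
      [/\ in_block lambda M, simple_module M
        & has_dim 1 (whittaker_vectors lambda M)].
Proof. by move=> _ whitt ds lambda; exact: (exists_simple_whittaker lambda whitt ds). Qed.
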